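(* Let $f:\mathbb{R}^n\to\mathbb{R}^n$ be continuously differentiable with Jacobian $J(x)$, let $\|\cdot\|$ be the Euclidean norm, and let $(x_j),(r_j),(P_j),(V_j),(y_j)$ be generated by the nlTGCR($m$) algorithm with line search described in the context, with $r_j=-f(x_j)$, $y_j=V_j^Tr_j$, $d_j=P_jy_j$ and $W_j=J(x_j)P_j-V_j$. For $t\in[0,1]$ put $x_{j+1}(t)=x_j+t\,d_j$ and $s_j(t)=f(x_j+t d_j)-f(x_j)-t\,J(x_j)d_j$. Assume: 1. (Exact line search) for every $j$, $x_{j+1}=\operatorname{argmin}_{x_{j+1}(t),\ t\in[0,1]}\|f(x_{j+1}(t))\|$, i.e. $x_{j+1}=x_{j+1}(t_j)$ where $t_j\in[0,1]$ minimizes $t\mapsto\|f(x_{j+1}(t))\|$ over $[0,1]$. 2. There is a constant $K\ge \tfrac12$ such that for every $j$ and every $t\in[0,1]$, $\|s_j(t)\|\le K\|f(x_j)\|\,t^2$. 3. There is a scalar $0\le\mu<1$ such that for every $j$, $\|W_jy_j\|\le\mu\|r_j\|$. 4. There is a scalar $\eta$ such that at every step $j$, $\|f(x_j)+V_jy_j\|\le\eta\,\|f(x_j)\|$, where $0<\eta<1-\mu$, i.e. $$c:=1-(\eta+\mu)>0.$$ Then $0<1-\frac{c^2}{4K}<1$, and at each step $j$ $$\|f(x_{j+1})\|\le\left[1-\frac{c^2}{4K}\right]\|f(x_j)\|.$$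
   Context: nlTGCR($m$) with line search ($m\ge1$ an integer window size). Write $j_m=\max\{0,j-m+1\}$. Given $x_0\in\mathbb{R}^n$, set $r_0=-f(x_0)$, $v=J(x_0)r_0$, $v_0=v/\|v\|_2$, $p_0=r_0/\|v\|_2$. For $j=0,1,2,\dots$, with $P_j=[p_{j_m},p_{j_m+1},\dots,p_j]$ and $V_j=[v_{j_m},v_{j_m+1},\dots,v_j]$: (i) $y_j=V_j^Tr_j$ and $d_j=P_jy_j$; (ii) $x_{j+1}=x_j+t_jd_j$, with $t_j\in[0,1]$ determined by the line search; (iii) $r_{j+1}=-f(x_{j+1})$; (iv) set $p:=r_{j+1}$ and $v:=J(x_{j+1})p$; then for $i=j_m,\dots,j$ successively set $\beta_{ij}:=\langle v,v_i\rangle$, $p:=p-\beta_{ij}p_i$, $v:=v-\beta_{ij}v_i$; (v) $p_{j+1}:=p/\|v\|_2$, $v_{j+1}:=v/\|v\|_2$. It is assumed that the vectors $v$ that are normalized are nonzero (no breakdown), so the columns of each $V_j$ are orthonormal. The columns of $W_j$ are $w_i=J(x_j)p_i-v_i$ for $i=j_m,\dots,j$. *)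

(* Defs.v *)
From HB Require Import structures.
From mathcomp Require Import all_boot all_order all_algebra.
From mathcomp Require Import all_classical all_reals all_analysis.
Import Order.TTheory GRing.Theory Num.Theory.
Import numFieldNormedType.Exports.

Set Implicit Arguments.
Unset Strict Implicit.
Unset Printing Implicit Defensive.

Local Open Scope ring_scope.

Definition dot (R : realType) (n : nat) (u v : 'cV[R]_n) : R :=
  (u^T *m v) 0 0.

(* The norm [`|u|] that MathComp-Analysis puts on matrices is the sup norm. *)
Definition enorm (R : realType) (n : nat) (u : 'cV[R]_n) : R :=
  Num.sqrt (dot u u).

(* The library's ['J f x] is for row vectors and acts on the right; this is
   its column-vector counterpart, J(x)_{ik} = (d f_i / d x_k)(x). *)
Definition jac (R : realType) (n : nat) (f : 'cV[R]_n -> 'cV[R]_n)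
    (x : 'cV[R]_n) : 'M[R]_n :=
  \matrix_(i, k) ('D_(delta_mx k 0) f x) i 0.

Lemma diff_jac (R : realType) (n : nat) (f : 'cV[R]_n -> 'cV[R]_n)
    (x u : 'cV[R]_n) :
  differentiable f x -> 'd f x u = jac f x *m u.
Proof.
move=> df; apply/matrixP => i k; rewrite (ord1 k) {k} mxE.
rewrite {1}(matrix_sum_delta u) linear_sum summxE; apply: eq_bigr => a _.
by rewrite big_ord1 linearZ !mxE -deriveE// mulrC.
Qed.

Definition continuously_differentiable (R : realType) (n : nat)
    (f : 'cV[R]_n -> 'cV[R]_n) : Prop :=
  (forall x, differentiable f x) /\ continuous (jac f).

(* j_m = max{0, j - m + 1}: natural-number subtraction truncates at 0. *)
Definition wstart (m j : nat) : nat := (j.+1 - m)%N.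

(* The matrix with columns q_{j_m}, ..., q_j. *)
Definition window (R : realType) (n m : nat) (q : nat -> 'cV[R]_n) (j : nat) :
    'M[R]_(n, j.+1 - wstart m j) :=
  \matrix_(i, k) q (wstart m j + k)%N i 0.

(* As in modified Gram-Schmidt, beta is computed from the current value a.2,
   and the same combination is subtracted from a.1. *)
Definition orthogonalize (R : realType) (n : nat) (p v : nat -> 'cV[R]_n)
    (s : seq nat) (a : 'cV[R]_n * 'cV[R]_n) : 'cV[R]_n * 'cV[R]_n :=
  foldl (fun a i => let beta := dot a.2 (v i) in
                    (a.1 - beta *: p i, a.2 - beta *: v i)) a s.

Section Algorithm.
Variables (R : realType) (n m : nat) (f : 'cV[R]_n -> 'cV[R]_n).
Variables (x p v : nat -> 'cV[R]_n) (t : nat -> R).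

Definition res (j : nat) : 'cV[R]_n := - f (x j).

Definition coef (j : nat) := (window m v j)^T *m res j.

Definition dir (j : nat) : 'cV[R]_n := window m p j *m coef j.

Definition jac_defect (j : nat) := jac f (x j) *m window m p j - window m v j.

(* (p_{j+1}, v_{j+1}) before both are divided by the norm of the second. *)
Definition unnormalized (j : nat) : 'cV[R]_n * 'cV[R]_n :=
  orthogonalize p v (index_iota (wstart m j) j.+1)
    (res j.+1, jac f (x j.+1) *m res j.+1).

(* A run may go on forever ([N = None]) or stop after finitely many steps
   ([N = Some k]: only the steps 0, ..., k - 1 are carried out), as happens
   when f(x_k) = 0 or when a window with m >= n has exhausted R^n. *)
Definition performed (N : option nat) (j : nat) : bool :=
  if N is Some k then (j < k)%N else true.

(* [p] and [v] are constrained at the index j only when step j is carried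
   out, since it is step j that uses them. *)
Record nltgcr (N : option nat) (x0 : 'cV[R]_n) : Prop := NlTGCR {
  nltgcr_x0 : x 0%N = x0;
  nltgcr_init : performed N 0 ->
    let w := jac f (x 0%N) *m res 0 in
    [/\ w != 0, v 0%N = (enorm w)^-1 *: w & p 0%N = (enorm w)^-1 *: res 0];
  nltgcr_step : forall j, performed N j ->
    [/\ 0 <= t j, t j <= 1 & x j.+1 = x j + t j *: dir j];
  nltgcr_basis : forall j, performed N j.+1 ->
    let w := unnormalized j in
    [/\ w.2 != 0, p j.+1 = (enorm w.2)^-1 *: w.1
      & v j.+1 = (enorm w.2)^-1 *: w.2]
}.

End Algorithm.

(* s(t) = f(x + t d) - f(x) - t J(x) d *)
Definition lin_error (R : realType) (n : nat) (f : 'cV[R]_n -> 'cV[R]_n)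
    (x d : 'cV[R]_n) (t : R) : 'cV[R]_n :=
  f (x + t *: d) - f x - t *: (jac f x *m d).

(* Main.v *)
Require Import Defs.
From HB Require Import structures.
From mathcomp Require Import all_boot all_order all_algebra.
From mathcomp Require Import all_classical all_reals all_analysis.
From mathcomp Require Import ring lra.
Import Order.TTheory GRing.Theory Num.Theory.
Import numFieldNormedType.Exports.
Local Open Scope ring_scope.

(** The line search beats any fixed step, so it is enough to exhibit one good
    tau between 0 and 1.  Since J(x_j) d_j = V_j y_j + W_j y_j, the displaced
    value splits as
      f(x_j + tau d_j) = (1 - tau) f(x_j) + tau (f(x_j) + V_j y_j)
                         + tau W_j y_j + s_j(tau),
    and the triangle inequality bounds its norm by
    (1 - c tau + K tau^2) |f(x_j)|, with c = 1 - (eta + mu)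
    ([enorm_displaced]).  The quadratic is smallest at tau = c / (2 K), which
    is at most 1 because c <= 1 <= 2 K, and its value there is
    1 - c^2 / (4 K).  The argument concerns each step separately.

    The norm in question is the square root of [dot u u], whose triangle
    inequality is derived from Cauchy-Schwarz ([dot_le_enorm]). *)

Section EuclideanNorm.
Context {R : realType} {n : nat}.
Implicit Types (u v w : 'cV[R]_n) (a : R).

Lemma dotE u v : dot u v = \sum_i u i 0 * v i 0.
Proof. by rewrite /dot mxE; apply: eq_bigr => i _; rewrite mxE. Qed.

Lemma dotC u v : dot u v = dot v u.
Proof. by rewrite !dotE; apply: eq_bigr => i _; rewrite mulrC. Qed.

Lemma dotDl u v w : dot (u + v) w = dot u w + dot v w.
Proof. by rewrite /dot linearD mulmxDl mxE. Qed.

Lemma dotZl a u v : dot (a *: u) v = a * dot u v.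
Proof. by rewrite /dot linearZ -scalemxAl mxE. Qed.

Lemma dotDr u v w : dot u (v + w) = dot u v + dot u w.
Proof. by rewrite dotC dotDl !(dotC u). Qed.

Lemma dotZr a u v : dot u (a *: v) = a * dot u v.
Proof. by rewrite dotC dotZl dotC. Qed.

Lemma dot_ge0 u : 0 <= dot u u.
Proof. by rewrite dotE; apply: sumr_ge0 => i _; rewrite -expr2 sqr_ge0. Qed.

Lemma dot_eq0 u : dot u u = 0 -> u = 0.
Proof.
rewrite dotE => /eqP; rewrite psumr_eq0 => [/allP u0|i _]; last first.
  by rewrite -expr2 sqr_ge0.
apply/matrixP => i k; rewrite (ord1 k) mxE.
by have := u0 i (mem_index_enum i); rewrite /= mulf_eq0 orbb => /eqP.
Qed.

Lemma enorm_ge0 u : 0 <= enorm u.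
Proof. exact: sqrtr_ge0. Qed.

Lemma sqr_enorm u : enorm u ^+ 2 = dot u u.
Proof. by rewrite /enorm sqr_sqrtr ?dot_ge0. Qed.

Lemma enorm_eq0 u : enorm u = 0 -> u = 0.
Proof. by move=> u0; apply: dot_eq0; rewrite -sqr_enorm u0 expr0n. Qed.

Lemma enormZ a u : enorm (a *: u) = `|a| * enorm u.
Proof.
by rewrite /enorm dotZl dotZr mulrA -expr2 sqrtrM ?sqr_ge0// sqrtr_sqr.
Qed.

Lemma enormN u : enorm (- u) = enorm u.
Proof. by rewrite -scaleN1r enormZ normrN1 mul1r. Qed.

(** Cauchy-Schwarz, from expanding | |v| u - |u| v |^2 >= 0; dividing by
    |u| |v| requires both vectors to be nonzero. *)
Lemma dot_le_enorm u v : dot u v <= enorm u * enorm v.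
Proof.
have [/enorm_eq0 ->|u0] := eqVneq (enorm u) 0.
  by rewrite -{1}(scale0r u) dotZl mul0r mulr_ge0 ?enorm_ge0.
have [/enorm_eq0 ->|v0] := eqVneq (enorm v) 0.
  by rewrite -{1}(scale0r v) dotZr mul0r mulr_ge0 ?enorm_ge0.
have uv_gt0 : 0 < enorm u * enorm v.
  by rewrite mulr_gt0// lt_neqAle eq_sym ?u0 ?v0 enorm_ge0.
have := dot_ge0 (enorm v *: u + - enorm u *: v).
rewrite !dotDl !dotDr !dotZl !dotZr (dotC v u) -!sqr_enorm => h.
rewrite -(ler_pM2l uv_gt0); nra.
Qed.

Lemma ler_enormD u v : enorm (u + v) <= enorm u + enorm v.
Proof.
rewrite -(@ler_pXn2r _ 2) ?nnegrE ?addr_ge0 ?enorm_ge0//.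
rewrite sqr_enorm dotDl !dotDr (dotC v u) -!sqr_enorm.
have := dot_le_enorm u v; nra.
Qed.

End EuclideanNorm.

(** One step, abstracted from how [P] and [V] were built: [J *m P - V] is the
    error made in using [V] for the images of the columns of [P], and it is
    combined with the residual left by projection and the Taylor remainder. *)
Lemma enorm_displaced {R : realType} {n k : nat} {f : 'cV[R]_n -> 'cV[R]_n}
    {x : 'cV[R]_n} {P V : 'M[R]_(n, k)} {y : 'cV[R]_k} {K mu eta tau : R} :
  0 <= tau <= 1 ->
  enorm (lin_error f x (P *m y) tau) <= K * enorm (f x) * tau ^+ 2 ->
  enorm ((jac f x *m P - V) *m y) <= mu * enorm (f x) ->
  enorm (f x + V *m y) <= eta * enorm (f x) ->
  enorm (f (x + tau *: (P *m y)))
    <= (1 - (1 - (eta + mu)) * tau + K * tau ^+ 2) * enorm (f x).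
Proof.
move=> /andP[tau0 tau1] hs hW hV.
have -> : f (x + tau *: (P *m y)) =
    (1 - tau) *: f x + tau *: (f x + V *m y)
    + tau *: ((jac f x *m P - V) *m y) + lin_error f x (P *m y) tau.
  rewrite /lin_error mulmxBl -mulmxA.
  by apply/matrixP => i l; rewrite !mxE; ring.
apply: (le_trans (ler_enormD _ _)).
have h1 := ler_enormD ((1 - tau) *: f x + tau *: (f x + V *m y))
  (tau *: ((jac f x *m P - V) *m y)).
have h2 := ler_enormD ((1 - tau) *: f x) (tau *: (f x + V *m y)).
move: h1 h2; rewrite !enormZ (ger0_norm tau0) ger0_norm ?subr_ge0// => h1 h2.
have h3 := ler_wpM2l tau0 hW.
have h4 := ler_wpM2l tau0 hV.
lra.
Qed.

Theorem theorem4p5 (R : realType) (n m : nat) (hm : (1 <= m)%N)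
    (f : 'cV[R]_n -> 'cV[R]_n) (hf : continuously_differentiable f)
    (x0 : 'cV[R]_n) (x p v : nat -> 'cV[R]_n) (t : nat -> R) (N : option nat)
    (hrun : nltgcr m f x p v t N x0)
    (exact_line_search : forall j, performed N j ->
       forall tau : R, 0 <= tau <= 1 ->
       enorm (f (x j + t j *: dir m f x p v j))
         <= enorm (f (x j + tau *: dir m f x p v j)))
    (K : R) (hK : 1 / 2 <= K)
    (hs : forall j, performed N j -> forall tau : R, 0 <= tau <= 1 ->
       enorm (lin_error f (x j) (dir m f x p v j) tau)
         <= K * enorm (f (x j)) * tau ^+ 2)
    (mu : R) (hmu : 0 <= mu < 1)
    (hW : forall j, performed N j ->
       enorm (jac_defect m f x p v j *m coef m f x v j)
         <= mu * enorm (res f x j))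
    (eta : R) (heta : 0 < eta < 1 - mu)
    (hV : forall j, performed N j ->
       enorm (f (x j) + window m v j *m coef m f x v j)
         <= eta * enorm (f (x j))) :
  let c := 1 - (eta + mu) in
  0 < 1 - c ^+ 2 / (4 * K) < 1 /\
  (forall j, performed N j ->
     enorm (f (x j.+1)) <= (1 - c ^+ 2 / (4 * K)) * enorm (f (x j))).
Proof.
move=> c.
have [/andP[mu0 mu1] /andP[eta0 eta1]] := (hmu, heta).
have c0 : 0 < c by rewrite /c; lra.
have c1 : c < 1 by rewrite /c; lra.
have K0 : 0 < K by lra.
split.
  have cK0 : 0 < c ^+ 2 / (4 * K) by rewrite divr_gt0 ?exprn_gt0//; lra.
  have cK1 : c ^+ 2 / (4 * K) < 1 by rewrite ltr_pdivrMr; nra.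
  by apply/andP; split; lra.
move=> j hj.
have [_ _ ->] := nltgcr_step hrun hj.
(* The minimizer of 1 - c tau + K tau^2. *)
pose tau := c / (2 * K).
have tau01 : 0 <= tau <= 1.
  by rewrite /tau divr_ge0 ?ler_pdivrMr ?mul1r/=; lra.
apply: (le_trans (exact_line_search _ hj _ tau01)).
have hWj : enorm (jac_defect m f x p v j *m coef m f x v j)
    <= mu * enorm (f (x j)) by rewrite -(enormN (f (x j))); apply: hW.
have := enorm_displaced tau01 (hs _ hj _ tau01) hWj (hV _ hj).
suff -> : 1 - (1 - (eta + mu)) * tau + K * tau ^+ 2 = 1 - c ^+ 2 / (4 * K).
  by [].
by rewrite -/c /tau; field; rewrite gt_eqF.
Qed.
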